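(* Let $G$ be the cyclic group of order $12$ (written multiplicatively). Then the set \[ A=\{x^2: x\in G\}\cup\{x^3: x\in G\}\] is closed under endomorphisms of $G$ (that is, $\varphi(a)\in A$ for every $a\in A$ and every group endomorphism $\varphi:G\to G$), but $A$ is not the image of any word map over $G$; that is, there do not exist an integer $n\ge 1$ and a word $w\in\mathbf{F}_n$ with $w(G)=A$.
   Context: $\mathbf{F}_n$ denotes the free group on $x_1,\dots,x_n$; its elements are called words. A word $w\in\mathbf{F}_n$ induces the word map $w:G^n\to G$, $(g_1,\dots,g_n)\mapsto w(g_1,\dots,g_n)$, obtained by substituting $g_i$ for $x_i$, and $w(G)$ denotes the image $w(G^n)$ of this map. *)

(* Defs.v *)
From HB Require Import structures.
From mathcomp Require Import all_boot all_fingroup all_solvable.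

Set Implicit Arguments.
Unset Strict Implicit.
Unset Printing Implicit Defensive.

Local Open Scope group_scope.

(* The letter (i, true) stands for x_i and (i, false) for x_i^-1. *)
Definition letter (n : nat) := ('I_n * bool)%type.

Definition inv_letter n (a : letter n) : letter n := (a.1, ~~ a.2).

Definition reduced n (s : seq (letter n)) : bool :=
  sorted (fun a b => b != inv_letter a) s.

(* Elements of the free group are represented by their unique reduced form. *)
Record free_group (n : nat) :=
  FreeGroup { letters :> seq (letter n); _ : reduced letters }.

HB.instance Definition _ n := [isSub for @letters n].
HB.instance Definition _ n := [Choice of free_group n by <:].

(* For reduced s, the reduced form of a :: s. *)
Definition push n (a : letter n) (s : seq (letter n)) : seq (letter n) :=
  if s is b :: s' then if b == inv_letter a then s' else a :: s else [:: a].

Section FreeGroup.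
Variable n : nat.
Implicit Types (a b : letter n) (s t r : seq (letter n)) (u v w : free_group n).

Lemma inv_letterK : involutive (@inv_letter n).
Proof. by case=> i e; rewrite /inv_letter /= negbK. Qed.

Lemma inv_letter_neq a : inv_letter a != a.
Proof. by case: a => i e; rewrite /inv_letter xpair_eqE eqxx; case: e. Qed.

Lemma reduced_push a s : reduced s -> reduced (push a s).
Proof.
case: s => [|b s] //= Hs; case: eqP => [_|/eqP Hb]; first exact: path_sorted Hs.
by rewrite /= Hb.
Qed.

Lemma pushK a s : reduced s -> push a (push (inv_letter a) s) = s.
Proof.
case: s => [|b s] /=; first by rewrite eqxx.
rewrite inv_letterK; case: eqP => [->|_] /=; last by rewrite eqxx.
by case: s => [|c s] //= /andP[/negPf->].
Qed.

Lemma pushVK a s : reduced s -> push (inv_letter a) (push a s) = s.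
Proof. by move=> Hs; rewrite -{2}[a]inv_letterK pushK. Qed.

Lemma reduced_cat_push s t : reduced t -> reduced (foldr (@push n) t s).
Proof. by move=> Ht; elim: s => //= a s; apply: reduced_push. Qed.

Lemma foldr_push a s r :
  reduced r -> foldr (@push n) r (push a s) = push a (foldr (@push n) r s).
Proof.
move=> Hr; case: s => [|b s] //=; case: eqP => [->|] //=.
by rewrite pushK // reduced_cat_push.
Qed.

Lemma foldr_pushA s t r : reduced r ->
  foldr (@push n) r (foldr (@push n) t s)
  = foldr (@push n) (foldr (@push n) r t) s.
Proof. by move=> Hr; elim: s => //= a s IHs; rewrite foldr_push // IHs. Qed.

Lemma foldr_push_nil s : reduced s -> foldr (@push n) [::] s = s.
Proof.
elim: s => //= a s IHs Hs; rewrite IHs; last exact: path_sorted Hs.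
by case: s Hs {IHs} => //= b s /andP[/negPf->].
Qed.

Definition inv_letters s := rev (map (@inv_letter n) s).

Lemma inv_lettersK : involutive inv_letters.
Proof.
by move=> s; rewrite /inv_letters map_rev revK -map_comp map_id_in // => a _;
  rewrite /= inv_letterK.
Qed.

Lemma reduced_inv s : reduced s -> reduced (inv_letters s).
Proof.
rewrite /reduced /inv_letters rev_sorted sorted_map; apply: sub_sorted => a b /=.
by rewrite inv_letterK; apply: contra => /eqP->.
Qed.

Lemma foldr_push_inv s r : reduced r ->
  foldr (@push n) (foldr (@push n) r s) (inv_letters s) = r.
Proof.
move=> Hr; elim: s => //= a s IHs.
rewrite /inv_letters map_cons rev_cons foldr_rcons pushVK ?reduced_cat_push //.
Qed.

Lemma letters_reduced u : reduced u. Proof. exact: valP u. Qed.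

Definition fg_one : free_group n := @FreeGroup n [::] isT.
Definition fg_mul u v : free_group n :=
  FreeGroup (reduced_cat_push u (letters_reduced v)).
Definition fg_inv u : free_group n :=
  FreeGroup (reduced_inv (letters_reduced u)).

Lemma fg_mulA : associative fg_mul.
Proof. by move=> u v w; apply: val_inj; rewrite /= foldr_pushA ?letters_reduced. Qed.

Lemma fg_mul1 : left_id fg_one fg_mul.
Proof. by move=> u; apply: val_inj. Qed.

Lemma fg_mulg1 : right_id fg_one fg_mul.
Proof. by move=> u; apply: val_inj; rewrite /= foldr_push_nil ?letters_reduced. Qed.

Lemma fg_mulV : left_inverse fg_one fg_inv fg_mul.
Proof.
move=> u; apply: val_inj => /=.
by rewrite -{1}[letters u]foldr_push_nil ?letters_reduced // foldr_push_inv.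
Qed.

Lemma fg_mulgV : right_inverse fg_one fg_inv fg_mul.
Proof.
move=> u; rewrite -[X in fg_mul X _](_ : fg_inv (fg_inv u) = u) ?fg_mulV //.
by apply: val_inj; rewrite /= inv_lettersK.
Qed.

HB.instance Definition _ := isGroup.Build (free_group n)
  fg_mulA fg_mul1 fg_mulg1 fg_mulV fg_mulgV.

Definition fg_gen (i : 'I_n) : free_group n := @FreeGroup n [:: (i, true)] isT.

Lemma fg_mulE u v : letters (u * v) = foldr (@push n) v u. Proof. by []. Qed.

End FreeGroup.

Definition eval_letter (H : groupType) n (g : 'I_n -> H) (a : letter n) : H :=
  if a.2 then g a.1 else (g a.1)^-1.

Definition word_map (H : groupType) n (w : free_group n) (g : 'I_n -> H) : H :=
  \prod_(a <- letters w) eval_letter g a.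

Lemma word_map_gen (H : groupType) n (g : 'I_n -> H) (i : 'I_n) :
  word_map (fg_gen i) g = g i.
Proof. by rewrite /word_map big_seq1. Qed.

Lemma word_mapM (H : groupType) n (g : 'I_n -> H) (u v : free_group n) :
  word_map (u * v) g = word_map u g * word_map v g.
Proof.
rewrite /word_map fg_mulE; elim: (letters u) => [|a s IHs] /=.
  by rewrite big_nil mul1g.
rewrite big_cons -mulgA -{}IHs.
case: (foldr _ _ s) => [|b t] /=; first by rewrite big_seq1 big_nil mulg1.
case: eqP => [->|_]; last by rewrite !big_cons.
rewrite big_cons /eval_letter /inv_letter /=.
by case: a.2; rewrite /= mulgA ?mulgV ?mulVg mul1g.
Qed.

(* The word map is restricted to tuples with entries in the subgroup G of gT. *)
Definition word_image (gT : finGroupType) (G : {group gT}) n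
    (w : free_group n) : {set gT} :=
  [set word_map w g | g : {ffun 'I_n -> gT} in ffun_on (mem G)].

(* Main.v *)
Require Import Defs.
From mathcomp Require Import all_boot all_fingroup all_solvable.

(* In an abelian group every word map is a homomorphism, so its image is closed
   under products. If c generates G then c^2 and c^3 lie in A, whereas c^5 does
   not: squares are killed by 6 and cubes by 4, but 12 divides neither 5 * 6
   nor 5 * 4. *)

Local Open Scope group_scope.

Section AbelianWordMap.
Context (gT : finGroupType) (G : {group gT}).

Lemma eval_letter_in n (g : 'I_n -> gT) (a : letter n) :
  (forall i, g i \in G) -> eval_letter g a \in G.
Proof. by move=> Gg; rewrite /eval_letter; case: ifP => _; rewrite ?groupV. Qed.

Context (abG : abelian G).

Lemma mulg_in_abelianC x y : x \in G -> y \in G -> x * y = y * x.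
Proof. by move=> Gx Gy; apply: (centsP abG). Qed.

(** Induction on the letters of [w]: each letter evaluates multiplicatively, and commutativity
    regroups the factors. *)
Lemma word_map_mul_in_abelian n (w : free_group n) (g h : 'I_n -> gT) :
    (forall i, g i \in G) -> (forall i, h i \in G) ->
  word_map w (fun i => g i * h i) = word_map w g * word_map w h.
Proof.
move=> Gg Gh.
rewrite /word_map; elim: (letters w) => [|a s IHs].
  by rewrite !big_nil mulg1.
(* Only elements of [G] are known to commute, so the tail must lie in [G] before the [h]-value of
   [a] can move past it. *)
have Gs : \prod_(b <- s) eval_letter g b \in G.
  by apply: group_prod => b _; apply: eval_letter_in.
rewrite !big_cons IHs.
have -> : eval_letter (fun i => g i * h i) a = eval_letter g a * eval_letter h a.
  rewrite /eval_letter; case: ifP => // _.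
  by rewrite invMg mulg_in_abelianC ?groupV.
rewrite -!mulgA; congr (_ * _); rewrite !mulgA; congr (_ * _).
by apply: mulg_in_abelianC => //; apply: eval_letter_in.
Qed.

Lemma word_image_mul_closed n (w : free_group n) x y :
  x \in word_image G w -> y \in word_image G w -> x * y \in word_image G w.
Proof.
case/imsetP=> g /ffun_onP Gg -> /imsetP[h /ffun_onP Gh ->].
rewrite -word_map_mul_in_abelian //; apply/imsetP.
(* The pointwise product of the two tuples is a preimage of [x * y]. *)
exists [ffun i => g i * h i]; first by apply/ffun_onP => i; rewrite ffunE groupM.
by apply: eq_bigr => a _; rewrite /eval_letter ffunE.
Qed.

End AbelianWordMap.

Theorem theorem3 (gT : finGroupType) (G : {group gT})
    (cycG : cyclic G) (oG : #|G| = 12%N) :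
  let A := [set x ^+ 2 | x in G] :|: [set x ^+ 3 | x in G] in
  (forall phi : {morphism G >-> gT}, phi @* G \subset G ->
     forall a : gT, a \in A -> phi a \in A)
  /\ ~ (exists (n : nat) (w : free_group n),
          (1 <= n)%N /\ word_image G w = A).
Proof.
move=> A; split.
  move=> phi sphiG a.
  (* Since [phi] preserves [G] and powers, it sends squares to squares and cubes to cubes. *)
  have Gphi x : x \in G -> phi x \in G.
    by move=> Gx; apply: (subsetP sphiG); apply: mem_morphim.
  case/setUP=> /imsetP[x Gx ->]; rewrite morphX //; apply/setUP; [left | right];
    by apply: imset_f; apply: Gphi.
case=> n [w [_ imA]]; have [c defG] := cyclicP cycG.
have Gc : c \in G by rewrite defG cycle_id.
have oc : #[c] = 12%N by rewrite orderE -defG.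
have Gexp x : x \in G -> x ^+ 12 = 1 by move=> Gx; rewrite -oG expg_cardG.
have : c ^+ 2 * c ^+ 3 \in A.
  rewrite -imA; apply: (word_image_mul_closed _ _ (cyclic_abelian cycG));
    rewrite imA; apply/setUP; [left | right]; exact: imset_f.
rewrite -expgD; case/setUP=> /imsetP[x Gx c5].
  (* From [c ^+ 5 = x ^+ 2], sixth powers give [c ^+ 30 = x ^+ 12 = 1]; for a cube, fourth powers
     give [c ^+ 20 = 1]. *)
  have : #[c] %| 5 * 6 by rewrite order_dvdn expgM c5 -expgM Gexp.
  by rewrite oc.
have : #[c] %| 5 * 4 by rewrite order_dvdn expgM c5 -expgM Gexp.
by rewrite oc.
Qed.
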